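(* Let a set-point $\omega_0>0$ be given and let $\eta=\omega_0/v_{dc,\mathrm{ref}}$. Consider the closed-loop system in error coordinates with state $(\tilde\xi,\tilde v_{dc},\tilde i_{dq},\tilde v_{dq})\in\mathbb{R}\times\mathbb{R}\times\mathbb{R}^2\times\mathbb{R}^2$, $$\dot{\tilde\xi}=\tilde v_{dc},$$ $$(C_{dc}+K_d)\dot{\tilde v}_{dc}=-(G_{dc}+K_p)\tilde v_{dc}-K_i\tilde\xi-\tfrac{\mu}{2}\mathbf{e}_2^\top\tilde i_{dq},$$ $$L\,\dot{\tilde i}_{dq}=-(\mathcal{Z}+\tilde v_{dc}\eta L\boldsymbol{J})\tilde i_{dq}+\tfrac{\mu}{2}\mathbf{e}_2\tilde v_{dc}-\tilde v_{dc}\eta L\boldsymbol{J}i_{dq}^*-\tilde v_{dq},$$ $$C\,\dot{\tilde v}_{dq}=-(\mathcal{Y}+\mathcal{Y}_l+\tilde v_{dc}\eta C\boldsymbol{J})\tilde v_{dq}-\tilde v_{dc}\eta C\boldsymbol{J}v_{dq}^*+\tilde i_{dq}.$$ The following two statements hold: 1. There exists a unique steady state at the origin, with $\omega^*=\omega_0$ as system frequency. 2. Assuming that $$\frac{C^2\lVert v_{dq}^*\rVert^2}{4(G+G_l)}+\frac{L^2\lVert i_{dq}^*\rVert^2}{4R}<\frac{G_{dc}+K_p}{\eta^2},$$ the zero equilibrium of this system is globally asymptotically stable.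
   Context: Here $\boldsymbol{I}$ is the $2\times2$ identity, $\boldsymbol{J}=\begin{bmatrix}0&-1\\1&0\end{bmatrix}$, $\mathbf{e}_2=\begin{bmatrix}0\\1\end{bmatrix}$, $\lVert\cdot\rVert$ is the Euclidean norm, $\mathcal{Z}=R\boldsymbol{I}+\omega_0L\boldsymbol{J}$, $\mathcal{Y}=G\boldsymbol{I}+\omega_0C\boldsymbol{J}$, $\mathcal{Y}_l=G_l\boldsymbol{I}+B_l\boldsymbol{J}$. The parameters $C_{dc},G_{dc},L,R,C,G,G_l,B_l,K_p,K_i,K_d,v_{dc,\mathrm{ref}},i_{dc,\mathrm{ref}}>0$ and $\mu\in[0,1]$ are constants. Origin of the error system: the converter model in $dq$-coordinates (frame angle $\theta$ with $\dot\theta=\omega=\eta v_{dc}$) is $$C_{dc}\dot v_{dc}=-G_{dc}v_{dc}+i_{dc}-\tfrac{\mu}{2}\mathbf{e}_2^\top i_{dq},\quad L\dot i_{dq}=-(R\boldsymbol{I}+v_{dc}\eta L\boldsymbol{J})i_{dq}+\tfrac{\mu}{2}\mathbf{e}_2v_{dc}-v_{dq},\quad C\dot v_{dq}=-(G\boldsymbol{I}+v_{dc}\eta C\boldsymbol{J})v_{dq}-i_{l,dq}+i_{dq},$$ with PID controller $i_{dc}=i_{dc,\mathrm{ref}}-K_p(v_{dc}-v_{dc,\mathrm{ref}})-K_i\xi-K_d\dot v_{dc}$, $\dot\xi=v_{dc}-v_{dc,\mathrm{ref}}$, and load $i_{l,dq}=\mathcal{Y}_lv_{dq}+s_{l,dq}$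 with constant $s_{l,dq}\in\mathbb{R}^2$. The starred quantities $(\xi^*,v_{dc}^*,i_{dq}^*,v_{dq}^* )$ denote the induced equilibrium values of this closed loop, with $v_{dc}^*=v_{dc,\mathrm{ref}}$; tildes denote errors with respect to them, and $\omega^*=\eta v_{dc}^*$ is the steady-state frequency. *)

(* Defs.v *)
(* MathComp-Analysis; the real numbers are an arbitrary [R : realType]. *)
From mathcomp Require Import all_boot all_order all_algebra.
From mathcomp Require Import all_classical all_reals all_analysis.

Set Implicit Arguments.
Unset Strict Implicit.
Unset Printing Implicit Defensive.

Import Order.TTheory GRing.Theory Num.Theory numFieldNormedType.Exports.
Local Open Scope classical_set_scope.
Local Open Scope ring_scope.

Section ImplicitODE.
Variables (R : realType) (V : normedModType R).

(* A system is a relation [F x dx] between a state and its time derivative, so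
   that a derivative may be multiplied by a coefficient or occur in a feedback
   law. *)
Variable F : V -> V -> Prop.

Definition steady_state (x : V) : Prop := F x 0.

(* Classical solution on [0, +oo[; the values of [x] at negative times are
   irrelevant. *)
Definition solution (x : R -> V) : Prop :=
  {within `[0, +oo[, continuous x} /\
  (forall t : R, 0 < t -> derivable x t 1 /\ F (x t) ('D_1 x t)).

(* The norm is the one of [V]; when [V] is finite-dimensional the notion does
   not depend on it. *)
Definition lyapunov_stable (xe : V) : Prop :=
  forall eps : R, 0 < eps -> exists2 delta : R, 0 < delta &
    forall x, solution x -> `|x 0 - xe| < delta ->
      forall t : R, 0 <= t -> `|x t - xe| < eps.

Definition globally_attractive (xe : V) : Prop :=
  forall x, solution x -> x t @[t --> +oo] --> xe.

(* Completeness excludes finite escape time: without it the two quantifications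
   over solutions on the whole of [0, +oo[ could hold vacuously. *)
Definition forward_complete : Prop :=
  forall x0 : V, exists2 x, solution x & x 0 = x0.

Definition globally_asymptotically_stable (xe : V) : Prop :=
  [/\ steady_state xe, forward_complete, lyapunov_stable xe
    & globally_attractive xe].

End ImplicitODE.

(* The subscript f marks the AC filter parameters L, R, C, G. *)
Record converter (R : realType) := Converter {
  Cdc : R; Gdc : R; Lf : R; Rf : R; Cf : R; Gf : R; Gl : R; Bl : R;
  Kp : R; Ki : R; Kd : R; vref : R; iref : R; mu : R;
  Cdc_gt0 : 0 < Cdc; Gdc_gt0 : 0 < Gdc;
  Lf_gt0 : 0 < Lf; Rf_gt0 : 0 < Rf; Cf_gt0 : 0 < Cf; Gf_gt0 : 0 < Gf;
  Gl_gt0 : 0 < Gl; Bl_gt0 : 0 < Bl;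
  Kp_gt0 : 0 < Kp; Ki_gt0 : 0 < Ki; Kd_gt0 : 0 < Kd;
  vref_gt0 : 0 < vref; iref_gt0 : 0 < iref;
  mu_ge0 : 0 <= mu; mu_le1 : mu <= 1 }.

Section Converter.
Variable R : realType.

Definition J : 'M[R]_2 := delta_mx 1 0 - delta_mx 0 1.
Definition e2 : 'cV[R]_2 := delta_mx 1 0.

(* The library norm on matrices is the sup norm, hence this definition. *)
Definition enorm (u : 'cV[R]_2) : R := Num.sqrt (\sum_i u i 0 ^+ 2).

(* (xi, v_dc, i_dq, v_dq) *)
Definition state : Type := (R * R * 'cV[R]_2 * 'cV[R]_2)%type.
Definition vdc_of (x : state) : R := x.1.1.2.
Definition idq_of (x : state) : 'cV[R]_2 := x.1.2.
Definition vdq_of (x : state) : 'cV[R]_2 := x.2.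

Variables (p : converter R) (omega0 : R).

Definition eta : R := omega0 / vref p.
Definition Zf : 'M[R]_2 := (Rf p)%:M + (omega0 * Lf p) *: J.
Definition Yf : 'M[R]_2 := (Gf p)%:M + (omega0 * Cf p) *: J.
Definition Yl : 'M[R]_2 := (Gl p)%:M + Bl p *: J.

Definition e2dot (u : 'cV[R]_2) : R := (e2^T *m u) 0 0.

(* The feedback current contains the derivative [dv] of [v_dc]. *)
Definition closed_loop (sl : 'cV[R]_2) (x dx : state) : Prop :=
  let: (xi, v, i, u) := x in
  let: (dxi, dv, di, du) := dx in
  let idc := iref p - Kp p * (v - vref p) - Ki p * xi - Kd p * dv in
  let il := Yl *m u + sl in
  [/\ dxi = v - vref p,
      Cdc p * dv = - Gdc p * v + idc - mu p / 2 * e2dot i,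
      Lf p *: di = - (((Rf p)%:M + (v * eta * Lf p) *: J) *m i)
                   + (mu p / 2 * v) *: e2 - u
    & Cf p *: du = - (((Gf p)%:M + (v * eta * Cf p) *: J) *m u) - il + i].

(* [xs] is the state of [closed_loop] with respect to which the errors are
   taken. *)
Definition error_system (xs x dx : state) : Prop :=
  let: (xi, v, i, u) := x in
  let: (dxi, dv, di, du) := dx in
  [/\ dxi = v,
      (Cdc p + Kd p) * dv
        = - (Gdc p + Kp p) * v - Ki p * xi - mu p / 2 * e2dot i,
      Lf p *: di = - ((Zf + (v * eta * Lf p) *: J) *m i)
                   + (mu p / 2 * v) *: e2
                   - (v * eta * Lf p) *: (J *m idq_of xs) - u
    & Cf p *: du = - ((Yf + Yl + (v * eta * Cf p) *: J) *m u)
                   - (v * eta * Cf p) *: (J *m vdq_of xs) + i].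

End Converter.

(* Main.v *)
Require Import Defs.
From mathcomp Require Import all_boot all_order all_algebra.
From mathcomp Require Import all_classical all_reals all_analysis.
From mathcomp Require Import ring lra.
Import Order.TTheory GRing.Theory Num.Theory numFieldNormedType.Exports.
Local Open Scope classical_set_scope.
Local Open Scope ring_scope.
Set Implicit Arguments.
Unset Strict Implicit.
Unset Printing Implicit Defensive.

(** The error system is a quadratic vector field on a six-dimensional space, and
    everything rests on one quadratic Lyapunov function.

    Write D = Cdc + Kd for the total capacitance of the DC side.  Along the
    trajectories the stored energy
      (Ki xi^2 + D v^2 + Lf |i|^2 + Cf |u|^2) / 2
    decreases at the rate
      (Gdc + Kp) v^2 + Rf |i|^2 + (Gf + Gl) |u|^2
        - v eta Lf (i x i_star) - v eta Cf (u x u_star),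
    where x is the planar cross product and the star marks the set-point:
    the couplings between xi, v, i and u exchange energy without loss, and the
    rotations of i and u by J, among them the products with v that make the
    system nonlinear, do no work since J is skew.  Completing the squares in i
    and u shows that this quadratic form is positive definite in (v, i, u)
    exactly under the strict inequality of the second claim
    (dissipation_coercive).  It does not see xi.
    Instead of an invariance principle, the small cross term eps D xi v is added
    to the energy: its derivative contains - eps Ki xi^2, and the remaining
    terms are absorbed by the dissipation.  The modified energy W is still
    equivalent to the squared norm (energy_bounds) and satisfies
    W' <= - k W for some k > 0 on the whole space (strict_lyapunov), hence
    W (x t) <= exp (- k t) W (x 0) along every solution (energy_decay).
    Stability and global attractivity follow at once.

    There remains the existence of solutions on the whole half-line.  For a
    globally Lipschitz field, Picard iteration converges on [0, +oo[ at once
    when measured against the weight exp (2 K t) (picard_lindelof).  The error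
    field is only locally Lipschitz, so its argument is first clipped to a large
    cube.  The cube contains a sublevel set of W that the initial point lies in,
    and since W cannot increase while the solution stays in that set, the
    solution never leaves it and the clipping never acts (global_solution).

    The first claim is a computation: at a steady state v = 0, and the power
    balance then forces i = u = 0. *)

(** * Comparison of functions through their derivatives, and primitives *)

Lemma derive_le0_le (R : realType) (f f' : R -> R) (a b : R) : a <= b ->
  {within `[a, b], continuous f} ->
  (forall s : R, a < s -> s < b -> is_derive s 1 f (f' s)) ->
  (forall s : R, a < s -> s < b -> f' s <= 0) -> f b <= f a.
Proof.
rewrite le_eqVlt => /predU1P[-> //|ab] cf df f'0.
have [|c] := @MVT R f f' a b ab _ cf.
  by move=> s; rewrite in_itv/= => /andP[? ?]; exact: df.
rewrite in_itv/= => /andP[ac cb] fE.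
by rewrite -subr_le0 fE mulr_le0_ge0 ?f'0// subr_ge0 ltW.
Qed.

Lemma le_of_derive_le (R : realType) (g g' h h' : R -> R) (t : R) : 0 <= t ->
  {within `[0, t], continuous g} -> {within `[0, t], continuous h} ->
  (forall s : R, 0 < s -> is_derive s 1 g (g' s)) ->
  (forall s : R, 0 < s -> is_derive s 1 h (h' s)) ->
  (forall s : R, 0 < s -> g' s <= h' s) -> g 0 <= h 0 -> g t <= h t.
Proof.
move=> t0 cg ch dg dh gh gh0.
have : (g \- h) t <= (g \- h) 0.
  apply: (@derive_le0_le R _ (fun s => g' s - h' s)) => //.
  - by move=> x; apply: cvgB; [exact: cg|exact: ch].
  - by move=> s s0 _; apply: is_deriveB; [exact: dg|exact: dh].
  - by move=> s s0 _; rewrite subr_le0 gh.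
rewrite /=; lra.
Qed.

(** This replaces norm estimates of integrals: iterates of the Picard operator
    are compared through their derivatives only. *)
Lemma norm_le_of_derive_le (R : realType) (g g' h h' : R -> R) (t : R) : 0 <= t ->
  continuous g -> continuous h ->
  (forall s : R, 0 < s -> is_derive s 1 g (g' s)) ->
  (forall s : R, 0 < s -> is_derive s 1 h (h' s)) ->
  (forall s : R, 0 < s -> `|g' s| <= h' s) -> `|g 0| <= h 0 -> `|g t| <= h t.
Proof.
move=> t0 cg ch dg dh gh; rewrite !ler_norml => /andP[gh0 gh1].
have cg' := @continuous_subspaceT _ _ `[0, t] _ cg.
have ch' := @continuous_subspaceT _ _ `[0, t] _ ch.
apply/andP; split; last first.
  apply: (@le_of_derive_le R g g' h h') => // s s0.
  exact: le_trans (ler_norm _) (gh _ s0).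
rewrite lerNl.
apply: (@le_of_derive_le R (fun s => - g s) (fun s => - g' s) h h') => //.
- by move=> x; apply: cvgN; exact: cg'.
- by move=> s s0; apply: is_deriveN; exact: dg.
- by move=> s s0; apply: le_trans (gh _ s0); rewrite -normrN ler_norm.
- by rewrite lerNl.
Qed.

Lemma is_derive_continuous (R : realType) (f : R -> R) (t df : R) :
  is_derive t 1 f df -> {for t, continuous f}.
Proof.
by move=> /@ex_derive/derivable1_diffP; exact: differentiable_continuous.
Qed.

Lemma is_derive_expRM (R : realType) (k t : R) :
  is_derive t 1 (fun s => expR (k * s)) (k * expR (k * t)).
Proof.
have H : is_derive t 1 ( *%R k) k.
  have := is_deriveZ k (is_derive_id t (1 : R)).
  by rewrite /GRing.scale/= mulr1.
rewrite mulrC.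
exact: (@is_derive1_comp _ expR _ t _ _ (is_derive_expR _) H).
Qed.

Section Primitive.
Variable R : realType.

(** The lower bound -1 lies strictly before 0, so that the fundamental theorem
    of calculus applies around every t >= 0, and the truncation of t at 0
    makes the primitive of a continuous function continuous on the whole line:
    the Picard iterates never need a continuity statement on a half-line. *)
Definition primitive (phi : R -> R) (t : R) : R :=
  \int[@lebesgue_measure R]_(s in `[-1, Num.max t 0]) phi s -
  \int[@lebesgue_measure R]_(s in `[-1, 0]) phi s.

Lemma primitive_le0 phi t : t <= 0 -> primitive phi t = 0.
Proof. by move=> t0; rewrite /primitive max_r// subrr. Qed.

Lemma is_derive_integral (phi : R -> R) (t : R) : continuous phi -> -1 < t ->
  is_derive t 1
    (fun u => \int[@lebesgue_measure R]_(s in `[-1, u]) phi s) (phi t).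
Proof.
move=> cphi t1.
have [|//|dF FE] := @continuous_FTC1_closed R phi (-1) t (t + 1) _ _ t1 (cphi t).
- by rewrite ltrDl.
- apply: continuous_compact_integrable; first exact: segment_compact.
  exact: continuous_subspaceT.
- apply: DeriveDef => //; rewrite -FE derive1E//.
Qed.

Lemma is_derive_primitive phi (t : R) : continuous phi -> 0 < t ->
  is_derive t 1 (primitive phi) (phi t).
Proof.
move=> cphi t0.
pose F u := \int[@lebesgue_measure R]_(s in `[-1, u]) phi s.
have dF : is_derive t 1 (F - cst (F 0)) (phi t - 0).
  by apply: is_deriveB; apply: is_derive_integral => //; lra.
rewrite subr0 in dF.
apply: near_eq_is_derive dF.
near=> u; rewrite /primitive max_l//.
by apply: ltW; near: u; exact: lt_nbhsr.
Unshelve. all: by end_near. Qed.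

Lemma continuous_primitive phi : continuous phi -> continuous (primitive phi).
Proof.
move=> cphi t.
pose F u := \int[@lebesgue_measure R]_(s in `[-1, u]) phi s.
apply: cvgB; last exact: cvg_cst.
have cmax : {for t, continuous (fun u : R => Num.max u 0)}.
  by apply: continuous_max; [exact: cvg_id|exact: cvg_cst].
have cF : {for Num.max t 0, continuous F}.
  apply: (@is_derive_continuous _ _ _ (phi (Num.max t 0))).
  by apply: is_derive_integral => //; rewrite lt_max ltrN10 orbT.
exact: (continuous_comp cmax cF).
Qed.

End Primitive.

(** * Global solutions of globally Lipschitz equations *)

Lemma geometric_small (R : realType) (C e : R) : 0 < e ->
  exists n, C / 2 ^+ n < e.
Proof.
move=> e0; pose N := Num.bound `|C / e|.
exists N; rewrite ltr_pdivrMr ?exprn_gt0// mulrC -ltr_pdivrMr//.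
apply: (le_lt_trans (ler_norm _)); apply: lt_le_trans (archi_boundP (normr_ge0 _)) _.
by rewrite -natrX ler_nat; exact: ltnW (ltn_expl _ _).
Qed.

(** The intervals of centre u n and radius 2 C / 2 ^ n are nested, hence share a
    point, and their radii are the convergence rate. *)
Lemma geometric_cauchy (R : realType) (u : nat -> R) (C : R) :
  (forall n, `|u n.+1 - u n| <= C / 2 ^+ n) ->
  exists l, forall n, `|l - u n| <= 2 * C / 2 ^+ n.
Proof.
move=> uC.
pose a n := u n - 2 * C / 2 ^+ n; pose b n := u n + 2 * C / 2 ^+ n.
have half n : 2 * C / 2 ^+ n.+1 = C / 2 ^+ n.
  by rewrite exprS; field; rewrite expf_eq0 pnatr_eq0 andbF.
have C0 n : 0 <= C / 2 ^+ n by exact: le_trans (uC n).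
have aS n : a n <= a n.+1.
  by have := uC n; have := C0 n; rewrite /a half ler_norml -!mulrA; lra.
have bS n : b n.+1 <= b n.
  by have := uC n; have := C0 n; rewrite /b half ler_norml -!mulrA; lra.
have am : {homo a : m n / (m <= n)%N >-> m <= n}.
  by apply: homo_leq => //; exact: le_trans.
have bm : {homo b : m n / (m <= n)%N >-> n <= m}.
  by apply: homo_leq => // x y z xy yz; exact: le_trans yz xy.
have ab m n : a m <= b n.
  apply: (le_trans (am _ _ (leq_maxl m n))).
  apply: le_trans (bm _ _ (leq_maxr m n)).
  by rewrite /a /b -!mulrA; have := C0 (maxn m n); lra.
exists (sup (range a)) => n.
have al : a n <= sup (range a).
  apply: ub_le_sup; last by exists n.
  by exists (b 0%N) => _ [m _ <-].
have lb : sup (range a) <= b n.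
  by apply: ge_sup; [exists (a 0%N), 0%N|move=> _ [m _ <-]].
by rewrite ler_norml; move: al lb; rewrite /a /b; lra.
Qed.

Section Picard.
Variables (R : realType) (I : finType).
Variables (f : I -> (I -> R) -> R) (K : R) (x0 : I -> R).
Hypothesis K_gt0 : 0 < K.
Hypothesis f_lip : forall i x y (c : R),
  (forall j, `|x j - y j| <= c) -> `|f i x - f i y| <= K * c.

Let w (t : R) := expR (2 * K * t).

Let dw (c t : R) : is_derive t 1 (fun s => c * w s) (c * (2 * K * w t)).
Proof. exact: (is_deriveZ c (is_derive_expRM (2 * K) t)). Qed.

Let cw c : continuous (fun s => c * w s).
Proof. by move=> t; exact: is_derive_continuous (dw c t). Qed.

Definition picard (y : I -> R -> R) i t : R :=
  x0 i + primitive (fun s => f i (y ^~ s)) t.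

Definition continuous_family (y : I -> R -> R) := forall i, continuous (y i).

(** The hypothesis on f bounds differences by the supremum over the coordinates;
    since there are finitely many, coordinatewise continuity is enough. *)
Lemma continuous_lipschitz_comp y i : continuous_family y ->
  continuous (fun s => f i (y ^~ s)).
Proof.
move=> cy t; apply/cvgrPdist_le => e e0.
have eK : 0 < e / K by rewrite divr_gt0.
near=> s.
rewrite -[e](@divfK _ K) ?gt_eqF// [_ * K]mulrC.
apply: f_lip => j; move: j; near: s; apply: filter_forall => j.
by have /cvgrPdist_le := cy j t; exact.
Unshelve. all: by end_near. Qed.

Lemma continuous_picard y : continuous_family y ->
  continuous_family (picard y).
Proof.
move=> cy i t; apply: cvgD; first exact: cvg_cst.
exact/continuous_primitive/continuous_lipschitz_comp.
Qed.

Lemma is_derive_picard y i (t : R) : continuous_family y -> 0 < t ->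
  is_derive t 1 (picard y i) (f i (y ^~ t)).
Proof.
move=> cy t0; rewrite -[f i _]add0r.
apply: is_deriveD.
by apply: is_derive_primitive => //; exact: continuous_lipschitz_comp.
Qed.

Lemma picard_le0 y i t : t <= 0 -> picard y i t = x0 i.
Proof. by move=> t0; rewrite /picard primitive_le0// addr0. Qed.

(** The factor 1/2 comes from the exponent 2 K of the weight w: a bound c w on the
    difference of the arguments gives K c w for its derivative, which is
    the derivative of c w / 2. *)
Lemma picard_contraction y z c :
  continuous_family y -> continuous_family z ->
  (forall i (t : R), 0 <= t -> `|y i t - z i t| <= c * w t) ->
  forall i (t : R), 0 <= t -> `|picard y i t - picard z i t| <= c / 2 * w t.
Proof.
move=> cy cz yz i t t0.
apply: (@norm_le_of_derive_le R (fun s => picard y i s - picard z i s)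
  (fun s => f i (y ^~ s) - f i (z ^~ s)) (fun s => c / 2 * w s)
  (fun s => c / 2 * (2 * K * w s))) => //.
- by move=> s; apply: cvgB; exact: continuous_picard.
- by move=> s s0; apply: is_deriveB; exact: is_derive_picard.
- move=> s s0; rewrite (_ : c / 2 * _ = K * (c * w s)); last by field.
  by apply: f_lip => j; apply: yz; exact: ltW.
- rewrite !picard_le0// subrr normr0 mulr_ge0 ?expR_ge0// divr_ge0//.
  have := le_trans (normr_ge0 _) (yz i 0 (lexx _)).
  by rewrite pmulr_lge0 ?expR_gt0.
Qed.

Definition picard_iter n : I -> R -> R := iter n picard (fun i => cst (x0 i)).

Lemma continuous_picard_iter n : continuous_family (picard_iter n).
Proof.
elim: n => [i t|n IH]; first exact: cst_continuous.
exact: continuous_picard.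
Qed.

Lemma picard_iter_step : exists c, forall n i (t : R), 0 <= t ->
  `|picard_iter n.+1 i t - picard_iter n i t| <= c * w t / 2 ^+ n.
Proof.
pose B := \sum_i `|f i x0|.
have B0 : 0 <= B by exact: sumr_ge0.
have fB i : `|f i x0| <= B by rewrite /B (bigD1 i)//= lerDl sumr_ge0.
exists (B / (2 * K)); elim=> [|n IH] i t t0.
  rewrite expr0 divr1.
  apply: (@norm_le_of_derive_le R (fun s => picard_iter 1 i s - x0 i)
    (fun s => f i x0 - 0) (fun s => B / (2 * K) * w s)
    (fun s => B / (2 * K) * (2 * K * w s))) => //.
  - move=> s; apply: cvgB; last exact: cvg_cst.
    exact: (@continuous_picard_iter 1).
  - move=> s s0; apply: is_deriveB.
    exact: (is_derive_picard _ (@continuous_picard_iter 0)).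
  - move=> s s0; rewrite subr0 mulrA divfK ?gt_eqF ?mulr_gt0//.
    apply: (le_trans (fB i)); rewrite ler_peMr// /w -expR0 ler_expR.
    by rewrite mulr_ge0 ?ltW// mulr_gt0.
  - rewrite /picard_iter/= picard_le0// subrr normr0 mulr_ge0 ?expR_ge0//.
    by rewrite divr_ge0// ltW// mulr_gt0.
have -> : B / (2 * K) * w t / 2 ^+ n.+1 = B / (2 * K) / 2 ^+ n / 2 * w t.
  by rewrite exprS; field; rewrite expf_eq0 pnatr_eq0 andbF gt_eqF.
apply: picard_contraction; [exact: (@continuous_picard_iter n.+1)|
  exact: continuous_picard_iter| |exact: t0].
by move=> j s s0; rewrite [leRHS]mulrAC; exact: IH.
Qed.

(** By the contraction property the iterates converge at each t >= 0, at the
    geometric rate 2 c w t / 2 ^ n, which is uniform on bounded intervals; so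
    the limit is continuous and the Picard operator can be applied to it.  The
    image differs from the iterates by half as much, so it is the limit
    again. *)
Lemma picard_lindelof : exists y : I -> R -> R,
  [/\ continuous_family y, forall i, y i 0 = x0 i
    & forall i (t : R), 0 < t -> is_derive t 1 (y i) (f i (y ^~ t))].
Proof.
have [c cP] := picard_iter_step.
have [y yP] : exists y : I -> R -> R, forall n i (t : R), 0 <= t ->
    `|y i t - picard_iter n i t| <= 2 * c / 2 ^+ n * w t.
  have /choice[y yP] : forall it : I * R, exists l, 0 <= it.2 ->
      forall n, `|l - picard_iter n it.1 it.2| <= 2 * (c * w it.2) / 2 ^+ n.
    move=> [i t]/=; have [t0|_] := leP 0 t; last by exists 0.
    by have [l lP] := geometric_cauchy (fun n => cP n i t t0); exists l.
  exists (fun i t => y (i, t)) => n i t t0.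
  have /= := yP (i, t) t0 n.
  by rewrite [2 * (c * _)]mulrA [_ * w t / _]mulrAC.
(* The iterates are constant at negative times, and so is this extension of the
   limit. *)
pose z i t := y i (Num.max t 0).
have zE i (t : R) : 0 <= t -> z i t = y i t by move=> t0; rewrite /z max_l.
have it0 n i t : picard_iter n i t = picard_iter n i (Num.max t 0).
  have [//|t0] := leP 0 t.
  by case: n => [//|n]; rewrite /picard_iter/= !picard_le0// ltW.
have zP n i t : `|z i t - picard_iter n i t| <=
    2 * c / 2 ^+ n * w (Num.max t 0).
  by rewrite it0; apply: yP; rewrite le_max lexx orbT.
have zc : continuous_family z.
  move=> i t; apply/cvgrPdist_lt => e e0.
  have e3 : 0 < e / 3 by rewrite divr_gt0.
  have [n nP] := geometric_small (2 * c * w (Num.max t 0 + 1)) e3.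
  have close s : s <= t + 1 -> `|z i s - picard_iter n i s| < e / 3.
    move=> st; apply: le_lt_trans (zP n i s) _; apply: le_lt_trans nP.
    have c0 : 0 <= 2 * c / 2 ^+ n.
      have := le_trans (normr_ge0 _) (zP n i 0).
      by rewrite pmulr_lge0// expR_gt0.
    rewrite [leRHS]mulrAC ler_wpM2l// ler_expR ler_pM2l ?mulr_gt0//.
    rewrite ge_max; apply/andP; split.
      by apply: le_trans st _; rewrite lerD2r le_max lexx.
    by rewrite addr_ge0// le_max lexx orbT.
  have := @continuous_picard_iter n i t => /cvgrPdist_lt/(_ _ e3) cn.
  near=> s.
  have st : s <= t + 1 by apply: ltW; near: s; apply: lt_nbhsl; rewrite ltrDl.
  have h1 := close _ st.
  have h2 : `|picard_iter n i t - picard_iter n i s| < e / 3 by near: s.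
  have h3 : `|z i t - picard_iter n i t| < e / 3 by apply: close; rewrite lerDl.
  move: h1 h2 h3; rewrite !ltr_norml => /andP[? ?] /andP[? ?] /andP[? ?].
  by apply/andP; split; lra.
have fix_ i (t : R) : 0 <= t -> picard z i t = z i t.
  move=> t0; apply/eqP; rewrite -subr_eq0 -normr_le0 leNgt; apply/negP => d0.
  have [n] := geometric_small (2 * c * w t) d0.
  apply/negP; rewrite -leNgt.
  have h1 : `|picard z i t - picard_iter n.+1 i t| <= 2 * c / 2 ^+ n / 2 * w t.
    apply: picard_contraction => //; first exact: continuous_picard_iter.
    by move=> j s s0; rewrite zE//; exact: yP.
  have h2 : `|z i t - picard_iter n.+1 i t| <= 2 * c / 2 ^+ n / 2 * w t.
    have := yP n.+1 i t t0; rewrite zE// exprS.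
    by rewrite (_ : _ / (_ * _) = 2 * c / 2 ^+ n / 2)//; field;
      rewrite expf_eq0 pnatr_eq0 andbF.
  rewrite [leRHS]mulrAC.
  move: h1 h2; set a := _ / 2 ^+ n * w t.
  have -> : 2 * c / 2 ^+ n / 2 * w t = a / 2 by rewrite /a; field;
    rewrite expf_eq0 pnatr_eq0 andbF.
  rewrite !ler_norml => /andP[? ?] /andP[? ?].
  by apply/andP; split; lra.
exists z; split=> // [i|i t t0]; first by rewrite -fix_// picard_le0.
apply: near_eq_is_derive (is_derive_picard i zc t0).
near=> s; apply: fix_; apply: ltW; near: s; exact: lt_nbhsr.
Unshelve. all: by end_near. Qed.
End Picard.

(** * Quadratic estimates *)

Section Algebra.
Variable R : realFieldType.
(** The difference of the two sides is r times the sum of the squares of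
    a1 - v k p2 / (2 r) and a2 + v k p1 / (2 r). *)
Lemma cross_term_bound (r k v a1 a2 p1 p2 : R) : 0 < r ->
  v * k * (a1 * p2 - a2 * p1) <=
  r * (a1 ^+ 2 + a2 ^+ 2) + v ^+ 2 * (k ^+ 2 * (p1 ^+ 2 + p2 ^+ 2) / (4 * r)).
Proof.
move=> r0; rewrite -subr_ge0.
rewrite (_ : _ - _ = r * ((a1 - v * k * p2 / (2 * r)) ^+ 2
  + (a2 + v * k * p1 / (2 * r)) ^+ 2)).
  by apply: mulr_ge0; [exact: ltW|rewrite addr_ge0// sqr_ge0].
by field; rewrite gt_eqF.
Qed.

(** Completing the squares in a and b with the full coefficients r and s leaves
    g - A - B > 0 in front of v ^ 2, but nothing in front of a and b.  Using a
    fraction th < 1 of r and s instead costs (A + B) / th, which is still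
    less than g when th is the middle of (A + B) / g and 1. *)
Lemma dissipation_coercive (g r s k l p1 p2 q1 q2 : R) :
  0 < g -> 0 < r -> 0 < s ->
  k ^+ 2 * (p1 ^+ 2 + p2 ^+ 2) / (4 * r)
    + l ^+ 2 * (q1 ^+ 2 + q2 ^+ 2) / (4 * s) < g ->
  exists2 d, 0 < d & forall v a1 a2 b1 b2,
    d * (v ^+ 2 + (a1 ^+ 2 + a2 ^+ 2) + (b1 ^+ 2 + b2 ^+ 2)) <=
    g * v ^+ 2 + r * (a1 ^+ 2 + a2 ^+ 2) + s * (b1 ^+ 2 + b2 ^+ 2)
    - v * k * (a1 * p2 - a2 * p1) - v * l * (b1 * q2 - b2 * q1).
Proof.
move=> g0 r0 s0; set A := _ / (4 * r); set B := _ / (4 * s) => ABg.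
have A0 : 0 <= A.
  by rewrite /A divr_ge0// mulr_ge0 ?addr_ge0 ?sqr_ge0// ltW.
have B0 : 0 <= B.
  by rewrite /B divr_ge0// mulr_ge0 ?addr_ge0 ?sqr_ge0// ltW.
pose th := (A + B + g) / (2 * g).
have th0 : 0 < th by rewrite divr_gt0 ?mulr_gt0//; lra.
have th1 : th < 1 by rewrite ltr_pdivrMr ?mulr_gt0//; lra.
have gth : (A + B) / th < g.
  by rewrite ltr_pdivrMr// (_ : g * th = (A + B + g) / 2); [lra|
    rewrite /th; field; rewrite gt_eqF].
pose d := Num.min ((1 - th) * Num.min r s) (g - (A + B) / th).
have d0 : 0 < d.
  by rewrite lt_min mulr_gt0 ?subr_gt0// lt_min r0.
have dg : d <= g - (A + B) / th by rewrite ge_min lexx orbT.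
have th1' : 0 <= 1 - th by lra.
have dr : d <= (1 - th) * r.
  by rewrite ge_min ler_wpM2l// ge_min lexx.
have ds : d <= (1 - th) * s.
  by rewrite ge_min ler_wpM2l// ge_min lexx orbT.
exists d => // v a1 a2 b1 b2.
have ha := cross_term_bound k v a1 a2 p1 p2 (mulr_gt0 th0 r0).
have hb := cross_term_bound l v b1 b2 q1 q2 (mulr_gt0 th0 s0).
rewrite (_ : _ / (4 * (th * r)) = A / th) in ha; last first.
  by rewrite /A; field; rewrite !gt_eqF.
rewrite (_ : _ / (4 * (th * s)) = B / th) in hb; last first.
  by rewrite /B; field; rewrite !gt_eqF.
have h1 := ler_wpM2r (sqr_ge0 v) dg.
have h2 := ler_wpM2r (addr_ge0 (sqr_ge0 a1) (sqr_ge0 a2)) dr.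
have h3 := ler_wpM2r (addr_ge0 (sqr_ge0 b1) (sqr_ge0 b2)) ds.
move: h1 h2 h3 ha hb.
rewrite (mulrDl A B) mulrBl [(A / th + _) * _]mulrDl.
rewrite ![v ^+ 2 * (_ / th)]mulrC.
set ta := v * k * _; set tb := v * l * _.
set na := a1 ^+ 2 + a2 ^+ 2; set nb := b1 ^+ 2 + b2 ^+ 2.
rewrite !mulrDr !mulrBl !mul1r -!mulrA; lra.
Qed.

(** The coordinates are xi, v, the two entries of i, the two entries of u.  The
    last summand is the cross term that makes the integrator state visible to
    the dissipation. *)
Definition energy (kap D L C eps : R) (x : 'I_6 -> R) : R :=
  (kap * x 0 ^+ 2 + D * x 1 ^+ 2 + L * (x 2 ^+ 2 + x 3 ^+ 2)
    + C * (x 4 ^+ 2 + x 5 ^+ 2)) / 2 + eps * D * (x 0 * x 1).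

Definition normsq (x : 'I_6 -> R) : R :=
  x 0 ^+ 2 + x 1 ^+ 2 + x 2 ^+ 2 + x 3 ^+ 2 + x 4 ^+ 2 + x 5 ^+ 2.

(** For D eps ^ 2 <= kap / 4, Young's inequality bounds the cross term by half
    of the part of the energy that depends on x 0 and x 1. *)
Lemma energy_bounds (kap D L C eps : R) (x : 'I_6 -> R) :
  0 < kap -> 0 < D -> 0 < L -> 0 < C -> D * eps ^+ 2 <= kap / 4 ->
  Num.min (Num.min kap D) (Num.min L C) / 4 * normsq x
    <= energy kap D L C eps x <= (kap + D + L + C) * normsq x.
Proof.
move=> k0 D0 L0 C0 Deps.
have y0 i : 0 <= x i ^+ 2 by exact: sqr_ge0.
set m := Num.min _ _.
have mk : m <= kap by rewrite !ge_min lexx.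
have mD : m <= D by rewrite !ge_min lexx orbT.
have mL : m <= L by rewrite !ge_min lexx !orbT.
have mC : m <= C by rewrite !ge_min lexx !orbT.
(* Both signs of the cross term are needed: s = 1 for the lower bound and
   s = -1 for the upper one. *)
have cross s : s ^+ 2 = 1 ->
    - (s * (eps * D * (x 0 * x 1))) <= kap / 4 * x 0 ^+ 2 + D / 4 * x 1 ^+ 2.
  move=> s2; rewrite -subr_ge0.
  rewrite (_ : _ - _ = D / 4 * (x 1 + 2 * s * eps * x 0) ^+ 2 +
    (kap / 4 - D * eps ^+ 2 * s ^+ 2) * x 0 ^+ 2); last by field.
  rewrite s2 mulr1 addr_ge0// mulr_ge0 ?sqr_ge0 ?subr_ge0//.
  by rewrite divr_ge0// ltW.
have c1 := cross 1 (expr1n _ _).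
have cN1 := cross (-1) (etrans (sqrrN _) (expr1n _ _)).
have up u v i : u <= v -> u * x i ^+ 2 <= v * x i ^+ 2 by exact: ler_wpM2r.
have up0 u i : 0 < u -> 0 <= u * x i ^+ 2 by move=> /ltW u0; exact: mulr_ge0.
have := (up _ _ 0 mk, up _ _ 1 mD, up _ _ 2 mL, up _ _ 3 mL, up _ _ 4 mC,
  up _ _ 5 mC).
rewrite /energy /normsq !mulrDr !mulrDl.
have := (up0 _ 0 k0, up0 _ 0 D0, up0 _ 0 L0, up0 _ 0 C0).
have := (up0 _ 1 k0, up0 _ 1 D0, up0 _ 1 L0, up0 _ 1 C0).
have := (up0 _ 2 k0, up0 _ 2 D0, up0 _ 2 L0, up0 _ 2 C0).
have := (up0 _ 3 k0, up0 _ 3 D0, up0 _ 3 L0, up0 _ 3 C0).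
have := (up0 _ 4 k0, up0 _ 4 D0, up0 _ 4 L0, up0 _ 4 C0).
have := (up0 _ 5 k0, up0 _ 5 D0, up0 _ 5 L0, up0 _ 5 C0).
move: c1 cN1; clear; move=> ? ?.
do 6 (case=> [[[? ?] ?] ?]); case=> [[[[[? ?] ?] ?] ?] ?].
apply/andP; split; lra.
Qed.
End Algebra.

(** * The energy along a curve *)

Lemma is_derive_ext (R : realType) (f g : R -> R) (t df dg : R) :
  f =1 g -> df = dg -> is_derive t 1 g dg -> is_derive t 1 f df.
Proof. by move=> /funext -> ->. Qed.

Section EnergyRate.
Variable R : realType.

Definition energy_rate (kap D L C eps : R) (x dx : 'I_6 -> R) : R :=
  kap * (x 0 * dx 0) + D * (x 1 * dx 1) + L * (x 2 * dx 2 + x 3 * dx 3)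
  + C * (x 4 * dx 4 + x 5 * dx 5) + eps * D * (dx 0 * x 1 + x 0 * dx 1).

Lemma is_derive_energy (kap D L C eps : R) (y : 'I_6 -> R -> R)
    (dy : 'I_6 -> R) (t : R) :
  (forall i, is_derive t 1 (y i) (dy i)) ->
  is_derive t 1 (fun s => energy kap D L C eps (y ^~ s))
    (energy_rate kap D L C eps (y ^~ t) dy).
Proof.
move=> dyP.
have d i j := is_deriveM (dyP i) (dyP j).
have H := is_deriveD (is_deriveZ 2^-1 (is_deriveD (is_deriveD (is_deriveD
  (is_deriveZ kap (d 0 0)) (is_deriveZ D (d 1 1)))
  (is_deriveZ L (is_deriveD (d 2 2) (d 3 3))))
  (is_deriveZ C (is_deriveD (d 4 4) (d 5 5)))))
  (is_deriveZ (eps * D) (d 0 1)).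
apply: (is_derive_ext _ _ H) => [s|].
  by rewrite /energy !fctE/= /GRing.scale/=; field.
by rewrite /energy_rate/= /GRing.scale/=; field.
Qed.
End EnergyRate.

Section Decay.
Variables (R : realType) (kap D L C eps k : R).
Variable fld : ('I_6 -> R) -> 'I_6 -> R.
Let E := energy kap D L C eps.
Hypothesis rate : forall x, energy_rate kap D L C eps x (fld x) <= - k * E x.

Lemma continuous_energy (T : topologicalType) (y : 'I_6 -> T -> R) :
  (forall i, continuous (y i)) -> continuous (fun s => E (y ^~ s)).
Proof.
move=> cy t.
have sq (a : R) i : (a * y i s ^+ 2) @[s --> t] --> a * y i t ^+ 2.
  by apply: cvgM; [exact: cvg_cst|apply: cvgM; exact: cy].
have sq2 (a : R) i j : (a * (y i s ^+ 2 + y j s ^+ 2)) @[s --> t] -->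
    a * (y i t ^+ 2 + y j t ^+ 2).
  apply: cvgM; [exact: cvg_cst|].
  by apply: cvgD; apply: cvgM; exact: cy.
apply: cvgD; last first.
  by apply: cvgM; [exact: cvg_cst|apply: cvgM; exact: cy].
by apply: cvgM; [apply: cvgD => //; apply: cvgD => //; apply: cvgD|exact: cvg_cst].
Qed.

(** The derivative of exp (k s) E (y s) is exp (k s) (E' + k E) <= 0. *)
Lemma energy_decay (y : 'I_6 -> R -> R) (T : R) : 0 <= T ->
  (forall i, {within `[0, T], continuous (y i)}) ->
  (forall i (s : R), 0 < s -> s < T -> is_derive s 1 (y i) (fld (y ^~ s) i)) ->
  E (y ^~ T) <= expR (- k * T) * E (y ^~ 0).
Proof.
move=> T0 cy dy.
pose h (s : R) : R := expR (k * s) * E (y ^~ s).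
pose h' (s : R) : R :=
  expR (k * s) * energy_rate kap D L C eps (y ^~ s) (fld (y ^~ s))
  + E (y ^~ s) * (k * expR (k * s)).
suff : h T <= h 0.
  rewrite /h mulr0 expR0 mul1r => hT.
  by rewrite mulNr expRN mulrC ler_pdivlMr ?expR_gt0// mulrC.
have ch : {within `[0, T], continuous h}.
  move=> t; apply: cvgM; last exact: (continuous_energy cy).
  apply: (@continuous_subspaceT _ _ `[0, T] (fun s => expR (k * s))) => u.
  exact: is_derive_continuous (is_derive_expRM k u).
have dh (s : R) : 0 < s -> s < T -> is_derive s 1 h (h' s).
  move=> s0 sT.
  have dE := is_derive_energy kap D L C eps (fun i => dy i s s0 sT).
  exact: (is_deriveM (is_derive_expRM k s) dE).
have h'0 (s : R) : 0 < s -> s < T -> h' s <= 0.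
  move=> _ _; rewrite (_ : h' s = expR (k * s) *
    (energy_rate kap D L C eps (y ^~ s) (fld (y ^~ s)) + k * E (y ^~ s)));
    last by rewrite /h'; ring.
  by rewrite pmulr_rle0 ?expR_gt0//; have := rate (y ^~ s); rewrite mulNr; lra.
exact: derive_le0_le T0 ch dh h'0.
Qed.
End Decay.

(** * The error system in coordinates *)

(** It phrases the case analysis with the numerals that index the coordinates
    below, not with the constructor of ordinals. *)
Lemma ord6P (P : 'I_6 -> Prop) :
  P 0 -> P 1 -> P 2 -> P 3 -> P 4 -> P 5 -> forall i, P i.
Proof.
move=> P0 P1 P2 P3 P4 P5 [[|[|[|[|[|[|//]]]]]] i6].
- by rewrite (_ : Ordinal _ = 0)//; apply/val_inj.
- by rewrite (_ : Ordinal _ = 1)//; apply/val_inj.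
- by rewrite (_ : Ordinal _ = 2)//; apply/val_inj.
- by rewrite (_ : Ordinal _ = 3)//; apply/val_inj.
- by rewrite (_ : Ordinal _ = 4)//; apply/val_inj.
- by rewrite (_ : Ordinal _ = 5)//; apply/val_inj.
Qed.

Section Coordinates.
Variable R : realType.

Lemma sum_ord2 (F : 'I_2 -> R) : \sum_i F i = F 0 + F 1.
Proof.
by rewrite !big_ord_recl big_ord0 addr0; congr (_ + F _); apply/val_inj.
Qed.

Lemma col2E (u v : 'cV[R]_2) : (u = v) = (u 0 0 = v 0 0 /\ u 1 0 = v 1 0).
Proof.
apply/propext; split=> [->//|[h0 h1]]; apply/matrixP => i j; rewrite ord1.
by case: i => [[|[|//]] i2];
  [move: h0|move: h1]; congr (u _ _ = v _ _); apply/val_inj.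
Qed.

Definition state_coord (x : state R) (i : 'I_6) : R :=
  [:: x.1.1.1; x.1.1.2; x.1.2 0 0; x.1.2 1 0; x.2 0 0; x.2 1 0]`_i.

Definition of_coords (y : 'I_6 -> R) : state R :=
  (y 0, y 1, \col_i (if i == 0 then y 2 else y 3),
   \col_i (if i == 0 then y 4 else y 5)).

Lemma of_coordsK y : state_coord (of_coords y) = y.
Proof. by apply/funext; apply: ord6P; rewrite /state_coord/= ?mxE. Qed.

Lemma state_coord_inj : injective state_coord.
Proof.
move=> x y xy.
have h i : state_coord x i = state_coord y i by rewrite xy.
move: (h 0) (h 1) (h 2) (h 3) (h 4) (h 5).
case: x y {xy h} => [[[x0 x1] x2] x3] [[[y0 y1] y2] y3].
rewrite /state_coord/= => -> -> h2 h3 h4 h5.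
by congr (_, _, _); rewrite col2E.
Qed.

End Coordinates.

Section ErrorField.
Variables (R : realType) (p : converter R) (omega0 : R) (xs : state R).

Let D := Cdc p + Kd p.
Let eL := eta p omega0 * Lf p.
Let eC := eta p omega0 * Cf p.
Let Om := omega0 * Cf p + Bl p.

(** The implicit system solved for the derivatives, in coordinates. *)
Definition error_field (x : 'I_6 -> R) (i : 'I_6) : R := [::
  x 1;
  (- (Gdc p + Kp p) * x 1 - Ki p * x 0 - mu p / 2 * x 3) / (Cdc p + Kd p);
  (- (Rf p * x 2 - omega0 * Lf p * x 3) + x 1 * eL * (x 3 + idq_of xs 1 0)
     - x 4) / Lf p;
  (- (Rf p * x 3 + omega0 * Lf p * x 2) - x 1 * eL * (x 2 + idq_of xs 0 0)
     + mu p / 2 * x 1 - x 5) / Lf p;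
  (- ((Gf p + Gl p) * x 4 - Om * x 5) + x 1 * eC * (x 5 + vdq_of xs 1 0)
     + x 2) / Cf p;
  (- ((Gf p + Gl p) * x 5 + Om * x 4) - x 1 * eC * (x 4 + vdq_of xs 0 0)
     + x 3) / Cf p]`_i.

Lemma error_systemE x dx :
  error_system p omega0 xs x dx <-> state_coord dx = error_field (state_coord x).
Proof.
have eqdiv (a b c : R) : 0 < c -> (a = b / c) = (c * a = b).
  by move=> c0; apply/propext; split=> [->|<-]; field; rewrite gt_eqF.
have D0 : 0 < D by rewrite addr_gt0 ?Cdc_gt0 ?Kd_gt0.
have mul2 m (A : 'M[R]_(m, 2)) (u : 'cV[R]_2) i :
    (A *m u) i 0 = A i 0 * u 0 0 + A i 1 * u 1 0.
  by rewrite mxE sum_ord2.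
have [L0 C0] := (Lf_gt0 p, Cf_gt0 p).
have -> : error_system p omega0 xs x dx <-> [/\
  state_coord dx 0 = error_field (state_coord x) 0,
  state_coord dx 1 = error_field (state_coord x) 1,
  state_coord dx 2 = error_field (state_coord x) 2 /\
  state_coord dx 3 = error_field (state_coord x) 3 &
  state_coord dx 4 = error_field (state_coord x) 4 /\
  state_coord dx 5 = error_field (state_coord x) 5].
  case: x dx => [[[xi v] i] u] [[[dxi dv] di] du].
  rewrite /error_system !col2E /state_coord /error_field/= !eqdiv//.
  rewrite /e2dot /J /e2 !(mul2, mxE)/=.
  rewrite /eL /eC /Om.
  by split=> -[h0 h1 [h2 h3] [h4 h5]]; (split; [exact: h0|lra|split; lra|split; lra]).
split=> [[h0 h1 [h2 h3] [h4 h5]]|->//].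
by apply/funext; apply: ord6P.
Qed.

(** The power balance.  The coupling terms cancel, and the rotations by J
    contribute nothing except through the set-point xs. *)
Lemma energy_rate_error_field (eps : R) (x : 'I_6 -> R) :
  energy_rate (Ki p) D (Lf p) (Cf p) eps x (error_field x) =
  eps * (D * x 1 ^+ 2 - Ki p * x 0 ^+ 2
         - x 0 * ((Gdc p + Kp p) * x 1 + mu p / 2 * x 3))
  - ((Gdc p + Kp p) * x 1 ^+ 2 + Rf p * (x 2 ^+ 2 + x 3 ^+ 2)
     + (Gf p + Gl p) * (x 4 ^+ 2 + x 5 ^+ 2)
     - x 1 * eL * (x 2 * idq_of xs 1 0 - x 3 * idq_of xs 0 0)
     - x 1 * eC * (x 4 * vdq_of xs 1 0 - x 5 * vdq_of xs 0 0)).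
Proof.
have D0 : 0 < D by rewrite addr_gt0 ?Cdc_gt0 ?Kd_gt0.
have [L0 C0] := (Lf_gt0 p, Cf_gt0 p).
rewrite /energy_rate /error_field/= -/D; field.
by rewrite !gt_eqF.
Qed.

Lemma enorm_sqr (u : 'cV[R]_2) : enorm u ^+ 2 = u 0 0 ^+ 2 + u 1 0 ^+ 2.
Proof. by rewrite sqr_sqrtr ?sum_ord2// addr_ge0 ?sqr_ge0. Qed.

Hypothesis omega0_gt0 : 0 < omega0.
Hypothesis damping :
  Cf p ^+ 2 * enorm (vdq_of xs) ^+ 2 / (4 * (Gf p + Gl p))
     + Lf p ^+ 2 * enorm (idq_of xs) ^+ 2 / (4 * Rf p)
     < (Gdc p + Kp p) / eta p omega0 ^+ 2.

(** The energy without the cross term has rate at most - d M, where M is the sum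
    of the squares of all coordinates except xi.  The cross term adds at most
    eps (c M - Ki xi ^ 2 / 2); for eps c <= d / 2 the sum is negative definite.
    The other two conditions on eps yield D eps ^ 2 <= Ki / 4, as required by
    energy_bounds. *)
Lemma strict_lyapunov : exists eps lo hi k : R,
  [/\ 0 < lo, 0 < hi, 0 < k,
      forall x, lo * normsq x <= energy (Ki p) D (Lf p) (Cf p) eps x <=
                hi * normsq x
    & forall x, energy_rate (Ki p) D (Lf p) (Cf p) eps x (error_field x) <=
                - k * energy (Ki p) D (Lf p) (Cf p) eps x].
Proof.
have D0 : 0 < D by rewrite addr_gt0 ?Cdc_gt0 ?Kd_gt0.
have [L0 C0] := (Lf_gt0 p, Cf_gt0 p).
have K0 := Ki_gt0 p.
set g := Gdc p + Kp p.
have g0 : 0 < g by rewrite addr_gt0 ?Gdc_gt0 ?Kp_gt0.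
have s0 : 0 < Gf p + Gl p by rewrite addr_gt0 ?Gf_gt0 ?Gl_gt0.
have eta0 : 0 < eta p omega0 by rewrite divr_gt0// vref_gt0.
set m := mu p / 2.
have [|d d0 dP] := @dissipation_coercive R g (Rf p) (Gf p + Gl p) eL eC
  (idq_of xs 0 0) (idq_of xs 1 0) (vdq_of xs 0 0) (vdq_of xs 1 0)
  g0 (Rf_gt0 p) s0.
  move: damping; rewrite !enorm_sqr ltr_pdivlMr ?exprn_gt0//.
  by apply: le_lt_trans; rewrite le_eqVlt /eL /eC; apply/predU1P; left; ring.
pose c := D + (g ^+ 2 + m ^+ 2) / Ki p.
have c0 : 0 < c by rewrite ltr_wpDr// divr_ge0 ?addr_ge0 ?sqr_ge0// ltW.
pose eps := Num.min (d / (2 * c)) (Num.min 1 (Ki p / (4 * D))).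
have eps0 : 0 < eps by rewrite !lt_min ltr01 !divr_gt0 ?mulr_gt0.
have epsc : eps * c <= d / 2.
  rewrite -ler_pdivlMr//.
  by rewrite -mulrA -invfM /eps ge_min lexx.
have eps1 : eps <= 1 by rewrite !ge_min lexx orbT.
have epsD : D * eps ^+ 2 <= Ki p / 4.
  apply: (@le_trans _ _ (D * eps)).
    by rewrite ler_pM2l// expr2 ler_piMr// ltW.
  rewrite mulrC -ler_pdivlMr// -mulrA -invfM.
  by rewrite /eps !ge_min lexx !orbT.
pose lo := Num.min (Num.min (Ki p) D) (Num.min (Lf p) (Cf p)) / 4.
pose hi := Ki p + D + Lf p + Cf p.
pose r := Num.min (d / 2) (eps * Ki p / 2).
have hi0 : 0 < hi by rewrite /hi 3?addr_gt0.
have r0 : 0 < r by rewrite /r lt_min !divr_gt0 ?mulr_gt0.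
have bounds x := @energy_bounds R (Ki p) D (Lf p) (Cf p) eps x K0 D0 L0 C0 epsD.
exists eps, lo, hi, (r / hi); split=> // [||x].
- by rewrite divr_gt0// !lt_min K0 D0 L0.
- by rewrite divr_gt0.
have rN : energy_rate (Ki p) D (Lf p) (Cf p) eps x (error_field x) <=
    - (r * normsq x).
  rewrite energy_rate_error_field -/g -/m.
  have := dP (x 1) (x 2) (x 3) (x 4) (x 5).
  set E := _ - x 1 * eC * _ => dE.
  set M := x 1 ^+ 2 + (x 2 ^+ 2 + x 3 ^+ 2) + (x 4 ^+ 2 + x 5 ^+ 2) in dE.
  have M0 : 0 <= M by rewrite !addr_ge0 ?sqr_ge0.
  (* Completing the square in x 0, then
     (g x 1 + m x 3)^2 <= 2 g^2 (x 1)^2 + 2 m^2 (x 3)^2: the defects of the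
     two steps are the first two summands below. *)
  have young : D * x 1 ^+ 2 - Ki p * x 0 ^+ 2 - x 0 * (g * x 1 + m * x 3) <=
      c * M - Ki p / 2 * x 0 ^+ 2.
    rewrite -subr_ge0.
    rewrite (_ : _ - _ = (Ki p * x 0 + (g * x 1 + m * x 3)) ^+ 2 / (2 * Ki p)
      + (g * x 1 - m * x 3) ^+ 2 / (2 * Ki p)
      + c * (x 2 ^+ 2 + x 4 ^+ 2 + x 5 ^+ 2)
      + (D + g ^+ 2 / Ki p) * x 3 ^+ 2 + m ^+ 2 / Ki p * x 1 ^+ 2).
      have K2 : 0 < 2 * Ki p by rewrite mulr_gt0.
      have sq (z u : R) : 0 < u -> 0 <= z ^+ 2 / u.
        by move=> u0; rewrite divr_ge0 ?sqr_ge0// ltW.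
      have cM : 0 <= c * (x 2 ^+ 2 + x 4 ^+ 2 + x 5 ^+ 2).
        by rewrite mulr_ge0 ?(ltW c0)// !addr_ge0 ?sqr_ge0.
      have Dg : 0 <= (D + g ^+ 2 / Ki p) * x 3 ^+ 2.
        by rewrite mulr_ge0 ?sqr_ge0// addr_ge0 ?sq// (ltW D0).
      have mk : 0 <= m ^+ 2 / Ki p * x 1 ^+ 2 by rewrite mulr_ge0 ?sqr_ge0 ?sq.
      have := sq (Ki p * x 0 + (g * x 1 + m * x 3)) _ K2.
      have := sq (g * x 1 - m * x 3) _ K2.
      by move=> ? ?; rewrite 4?addr_ge0.
    by rewrite /c /M; field; rewrite gt_eqF.
  have h1 := ler_wpM2l (ltW eps0) young.
  have h2 := ler_wpM2r M0 epsc.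
  have r1 : r * M <= d / 2 * M by rewrite ler_wpM2r// /r ge_min lexx.
  have r2 : r * x 0 ^+ 2 <= eps * Ki p / 2 * x 0 ^+ 2.
    by rewrite ler_wpM2r ?sqr_ge0// /r ge_min lexx orbT.
  rewrite (_ : normsq x = x 0 ^+ 2 + M); last by rewrite /normsq /M; ring.
  move: h1; rewrite [_ * (c * M - _)]mulrBr mulrA => h1.
  move: dE h1 h2 r1 r2; rewrite [r * (_ + M)]mulrDr; lra.
apply: (le_trans rN).
rewrite mulNr lerN2 mulrAC ler_pdivrMr// -mulrA ler_pM2l// [leRHS]mulrC.
by have /andP[] := bounds x.
Qed.
End ErrorField.

Section CoordTopology.
Variable R : realType.

Lemma state_coordB (x y : state R) i :
  state_coord (x - y) i = state_coord x i - state_coord y i.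
Proof. by move: i; apply: ord6P; rewrite /state_coord/= ?mxE. Qed.

Lemma state_coordZ (a : R) (x : state R) i : state_coord (a *: x) i = a * state_coord x i.
Proof. by move: i; apply: ord6P; rewrite /state_coord/= ?mxE. Qed.

Lemma norm_col2_le (u : 'cV[R]_2) (e : R) : 0 <= e ->
  (`|u| <= e) = (`|u 0 0| <= e) && (`|u 1 0| <= e).
Proof.
move=> e0; rewrite [`|u|]/Num.Def.normr/= mx_normrE; apply/idP/idP => [ue|].
  by apply/andP; split; apply: le_trans ue;
    [exact: (le_bigmax _ _ (0, 0))|exact: (le_bigmax _ _ (1, 0))].
move=> /andP[u0 u1]; apply: bigmax_le => // -[i j] _ /=; rewrite ord1.
by case: i => [[|[|//]]] i2; [move: u0|move: u1];
  congr (`|u _ _| <= e); apply/val_inj.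
Qed.

Lemma norm_state_le (x : state R) (e : R) : 0 <= e ->
  `|x| <= e <-> forall i, `|state_coord x i| <= e.
Proof.
move=> e0; rewrite !prod_normE/= !ge_max !norm_col2_le//.
split=> [/andP[/andP[/andP[h0 h1] /andP[h2 h3]] /andP[h4 h5]]|h].
  exact: ord6P.
by rewrite (h 0) (h 1) (h 2) (h 3) (h 4) (h 5).
Qed.

(** The topology of the state space is the product topology of its coordinates;
    applied to neighbourhood filters and to difference quotients, this
    transfers continuity and derivatives. *)
Lemma cvg_state_coordP (T : Type) (F : set_system T) (FF : Filter F)
    (x : T -> state R) (l : state R) :
  x @ F --> l <-> forall i, (fun t => state_coord (x t) i) @ F --> state_coord l i.
Proof.
split=> [xl i|xl].
  apply/cvgrPdist_le => e e0; near=> t.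
  rewrite -state_coordB; move: i; apply/norm_state_le; first exact: ltW.
  by near: t; move/cvgrPdist_le : xl; exact.
apply/cvgrPdist_le => e e0; near=> t.
apply/norm_state_le; first exact: ltW.
move=> i; rewrite state_coordB; move: i; near: t; apply: filter_forall => i.
by move/cvgrPdist_le : (xl i); exact.
Unshelve. all: by end_near. Qed.

Lemma is_derive_cvgP (V : normedModType R) (f : R -> V) (t : R) (df : V) :
  is_derive t 1 f df <->
  h^-1 *: (f (h *: 1 + t) - f t) @[h --> (0 : R)^'] --> df.
Proof.
split=> [[fd <-]|H]; first exact: fd.
apply: DeriveDef; first by apply/cvg_ex; exists df.
exact: cvg_lim.
Qed.

Lemma is_derive_state_coordP (x : R -> state R) (t : R) (dx : state R) :
  is_derive t 1 x dx <->
  forall i, is_derive t 1 (fun s => state_coord (x s) i) (state_coord dx i).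
Proof.
rewrite is_derive_cvgP cvg_state_coordP.
split=> H i; [apply/is_derive_cvgP|have /is_derive_cvgP := H i];
  by [move: (H i); under eq_fun do rewrite state_coordZ state_coordB
     |under [in X in _ -> X]eq_fun do rewrite state_coordZ state_coordB].
Qed.
End CoordTopology.

(** * Truncation and solutions on the half-line *)

Section Truncation.
Variables (R : realType) (I : finType) (i0 : I).

Definition clip (M z : R) : R := Num.max (- M) (Num.min z M).

Lemma clip_id (M z : R) : `|z| <= M -> clip M z = z.
Proof.
by rewrite ler_norml => /andP[h1 h2]; rewrite /clip min_l// max_r.
Qed.

Lemma clip_bound (M z : R) : 0 <= M -> `|clip M z| <= M.
Proof.
move=> M0; rewrite ler_norml /clip le_max lexx/= ge_max ge_min lexx orbT andbT.
by rewrite (le_trans _ M0)// oppr_le0.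
Qed.

Lemma clip_lipschitz (M a b : R) : `|clip M a - clip M b| <= `|a - b|.
Proof.
wlog ab : a b / a <= b.
  move=> H; have [/H//|/ltW/H] := leP a b.
  by rewrite distrC [leRHS]distrC.
rewrite distrC [leRHS]distrC /clip /Num.max /Num.min.
rewrite [leRHS]ger0_norm ?subr_ge0//.
case: (ltP a M) => ?; case: (ltP b M) => ?; try case: (ltP (- M) a) => ?;
  try case: (ltP (- M) b) => ?; try case: (ltP (- M) M) => ?;
  by rewrite ler_norml; apply/andP; split; lra.
Qed.

(** Boundedness is included to make the class stable under products, so that
    it contains every polynomial in clipped coordinates. *)
Definition bounded_lipschitz (g : (I -> R) -> R) := exists K : R,
  [/\ 0 <= K, forall x, `|g x| <= K
    & forall x y (c : R), (forall j, `|x j - y j| <= c) ->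
        `|g x - g y| <= K * c].

Lemma bounded_lipschitz_clip (M : R) i : 0 <= M ->
  bounded_lipschitz (fun x => clip M (x i)).
Proof.
move=> M0; exists (M + 1); split=> [|x|x y c xy]; first by rewrite addr_ge0.
  by apply: le_trans (clip_bound _ M0) _; rewrite lerDl.
apply: le_trans (clip_lipschitz _ _ _) _; apply: le_trans (xy i) _.
by rewrite ler_peMl ?lerDr// (le_trans _ (xy i)).
Qed.

Lemma bounded_lipschitz_cst (a : R) : bounded_lipschitz (fun=> a).
Proof.
exists `|a|; split=> // x y c xy; rewrite subrr normr0 mulr_ge0//.
exact: le_trans (xy i0).
Qed.

Lemma bounded_lipschitzN g :
  bounded_lipschitz g -> bounded_lipschitz (fun x => - g x).
Proof.
move=> [K [K0 gK gl]]; exists K; split=> // [x|x y c xy].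
  by rewrite normrN.
by rewrite -opprD normrN gl.
Qed.

Lemma bounded_lipschitzD g h : bounded_lipschitz g -> bounded_lipschitz h ->
  bounded_lipschitz (fun x => g x + h x).
Proof.
move=> [K [K0 gK gl]] [H [H0 hH hl]]; exists (K + H); split=> [|x|x y c xy].
- exact: addr_ge0.
- by apply: le_trans (ler_normD _ _) _; exact: lerD.
- rewrite opprD addrACA mulrDl; apply: le_trans (ler_normD _ _) _.
  by apply: lerD; [exact: gl|exact: hl].
Qed.

Lemma bounded_lipschitzM g h : bounded_lipschitz g -> bounded_lipschitz h ->
  bounded_lipschitz (fun x => g x * h x).
Proof.
move=> [K [K0 gK gl]] [H [H0 hH hl]]; exists (2 * (K * H)); split=> [|x|x y c xy].
- by rewrite !mulr_ge0.
- rewrite normrM; apply: (@le_trans _ _ (K * H)); first exact: ler_pM.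
  by rewrite ler_peMl ?mulr_ge0// ler1n.
- rewrite (_ : _ - _ = (g x - g y) * h x + g y * (h x - h y)); last by ring.
  apply: le_trans (ler_normD _ _) _; rewrite !normrM.
  rewrite (_ : 2 * _ * c = K * c * H + K * (H * c)); last by ring.
  by apply: lerD; apply: ler_pM => //; [exact: gl|exact: hl].
Qed.

End Truncation.

Section GlobalSolution.
Variables (R : realType) (kap D L C eps k lo : R).
Variable fld : ('I_6 -> R) -> 'I_6 -> R.
Let E := energy kap D L C eps.
Hypotheses (lo_gt0 : 0 < lo) (k_gt0 : 0 < k).
Hypothesis E_ge : forall x, lo * normsq x <= E x.
Hypothesis rate : forall x, energy_rate kap D L C eps x (fld x) <= - k * E x.
Hypothesis fld_trunc : forall M, 0 <= M -> forall i,
  bounded_lipschitz (fun x => fld (fun j => clip M (x j)) i).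

Lemma sqr_coord_le_normsq (x : 'I_6 -> R) i : x i ^+ 2 <= normsq x.
Proof.
have y0 j : 0 <= x j ^+ 2 by exact: sqr_ge0.
move: i (y0 0) (y0 1) (y0 2) (y0 3) (y0 4) (y0 5).
by apply: ord6P; rewrite /normsq; lra.
Qed.

Lemma normsq_ge0 (x : 'I_6 -> R) : 0 <= normsq x.
Proof. exact: le_trans (sqr_ge0 _) (sqr_coord_le_normsq x 0). Qed.

(** The field is replaced by its composition with the clipping at a level M such
    that the energy sublevel c > E x0 lies in the cube of half-side M.  The
    solution of the clipped equation cannot reach the level c: up to the first
    time t0 when it does, it solves the original equation, so that its
    energy at t0 is at most E x0. *)
Lemma global_solution (x0 : 'I_6 -> R) : exists y : 'I_6 -> R -> R,
  [/\ forall i, continuous (y i), forall i, y i 0 = x0 i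
    & forall i (t : R), 0 < t -> is_derive t 1 (y i) (fld (y ^~ t) i)].
Proof.
have E0 x : 0 <= E x.
  by apply: le_trans (E_ge x); rewrite mulr_ge0 ?normsq_ge0// ltW.
pose c := E x0 + lo; pose M := c / lo + 1.
have c0 : 0 <= c by rewrite addr_ge0// ltW.
have M1 : 1 <= M by rewrite lerDr divr_ge0// ltW.
have M0 : 0 <= M := le_trans ler01 M1.
(* M >= 1 gives M <= M ^+ 2, which avoids a square root in the definition of M. *)
have box x : E x <= c -> (fun j => clip M (x j)) = x.
  move=> xc; apply/funext => j; apply: clip_id.
  rewrite -(@ler_pXn2r _ 2)// ?nnegrE// real_normK ?num_real//.
  apply: le_trans (sqr_coord_le_normsq x j) _.
  apply: (@le_trans _ _ M); last by rewrite expr2 ler_peMl.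
  apply: (@le_trans _ _ (c / lo)); last by rewrite lerDl.
  by rewrite ler_pdivlMr// mulrC; exact: le_trans (E_ge x) xc.
have /choice[K KP] := fld_trunc M0.
have K0 i : 0 <= K i by have [] := KP i.
pose S := 1 + \sum_i K i.
have S0 : 0 < S by rewrite ltr_wpDr// sumr_ge0.
have KS i : K i <= S.
  by rewrite /S (bigD1 i)//= addrCA lerDl addr_ge0// sumr_ge0.
have [|y [cy y0 dy]] := @picard_lindelof R 'I_6
  (fun i x => fld (fun j => clip M (x j)) i) S x0 S0.
  move=> i x z d xz; have [_ _ /(_ _ _ _ xz) h] := KP i.
  by apply: le_trans h _; rewrite ler_wpM2r// (le_trans _ (xz i)).
have yc (T : R) : 0 <= T -> E (y ^~ T) < c.
  move=> T0; rewrite ltNge; apply/negP => cT.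
  (* The first time at the level c or above is the minimum of this compact set. *)
  pose A := `[0, T] `&` [set s | c <= E (y ^~ s)].
  have cA : compact A.
    apply: subclosed_compact (@segment_compact _ 0 T) _; last by move=> s [].
    apply: closedI; first exact: itv_closed_ends_closed.
    apply: (@preimage_closed _ R (fun s : R => E (y ^~ s)) [set r : R | c <= r]);
      last exact: closed_ge.
    by move=> t _; exact: continuous_energy.
  have A0 : A !=set0 by exists T; split=> //=; rewrite in_itv/= T0 lexx.
  have cid : {within A, continuous (fun s : R => s)}.
    by apply: continuous_subspaceT => s; exact: cvg_id.
  have [t0] := compact_EVT_min A0 cA cid.
  rewrite inE => -[/=]; rewrite in_itv/= => /andP[t00 t0T] ct0 t0min.
  have : E (y ^~ t0) <= expR (- k * t0) * E (y ^~ 0).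
    apply: (energy_decay rate t00) => [i|i s s0 st].
      exact: continuous_subspaceT.
    have -> : fld (y ^~ s) = fld (fun j => clip M (y j s)).
      rewrite box//; rewrite leNgt; apply/negP => cs.
      have : t0 <= s.
        apply: t0min; rewrite inE; split=> /=; last exact: ltW.
        by rewrite in_itv/= !ltW// (lt_le_trans st).
      by rewrite leNgt st.
    exact: dy.
  apply/negP; rewrite -ltNge (_ : y ^~ 0 = x0); last exact/funext.
  apply: (@le_lt_trans _ _ (E x0)).
    rewrite ler_piMl// -expR0 ler_expR mulNr oppr_le0 mulr_ge0// ltW//.
  by apply: lt_le_trans ct0; rewrite ltrDl.
exists y; split=> // i t t0.
rewrite -(box (y ^~ t)); first exact: dy.
exact/ltW/yc/ltW.
Qed.
End GlobalSolution.

(** * Stability of the error system *)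

Section ErrorSystem.
Variables (R : realType) (p : converter R) (omega0 : R) (xs : state R).

Lemma bounded_lipschitz_error_field (M : R) (i : 'I_6) : 0 <= M ->
  bounded_lipschitz
    (fun x => error_field p omega0 xs (fun j => clip M (x j)) i).
Proof.
move=> M0; have i0 : 'I_6 := 0.
move: i; apply: ord6P; rewrite /error_field/=;
repeat first [exact: bounded_lipschitz_clip | exact: bounded_lipschitz_cst
  | apply: bounded_lipschitzD | apply: bounded_lipschitzN
  | apply: bounded_lipschitzM].
Qed.

(** At a steady state v = 0 and the rate of change of the energy vanishes, so that
    the power balance leaves Rf |i| ^ 2 + (Gf + Gl) |u| ^ 2 = 0. *)
Lemma steady_stateP (x : state R) :
  steady_state (error_system p omega0 xs) x <-> x = 0.
Proof.
have [L0 C0] := (Lf_gt0 p, Cf_gt0 p).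
have D0 : 0 < Cdc p + Kd p by rewrite addr_gt0 ?Cdc_gt0 ?Kd_gt0.
have s0 : state_coord (0 : state R) = fun=> 0.
  by apply/funext; apply: ord6P; rewrite /state_coord/= ?mxE.
rewrite /steady_state error_systemE; split=> [|->]; last first.
  rewrite s0; apply/funext; apply: ord6P; rewrite /error_field/=;
  by rewrite ?(mulr0, mul0r, subr0, oppr0, addr0, add0r).
move=> H; apply: state_coord_inj; set z := state_coord x in H *.
have E i : error_field p omega0 xs z i = 0 by rewrite -H s0.
have z1 : z 1 = 0 by have := E 0.
have := energy_rate_error_field p omega0 xs 0 z.
rewrite -H s0 /energy_rate z1 !(mulr0, mul0r, subr0, addr0, add0r) expr0n/=.
rewrite mulr0 add0r.
set a := Rf p * _; set b := _ * (z 4 ^+ 2 + _) => /esym/eqP.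
have sq i : 0 <= z i ^+ 2 by exact: sqr_ge0.
have r0 := Rf_gt0 p.
have g0 : 0 < Gf p + Gl p by rewrite addr_gt0 ?Gf_gt0 ?Gl_gt0.
have a0 : 0 <= a by rewrite /a mulr_ge0 ?(ltW r0)// addr_ge0.
have b0 : 0 <= b by rewrite /b mulr_ge0 ?(ltW g0)// addr_ge0.
rewrite oppr_eq0 paddr_eq0// /a /b.
rewrite !mulf_eq0 (gt_eqF r0) (gt_eqF g0)/= !paddr_eq0// !sqrf_eq0.
move=> /andP[/andP[/eqP z2 /eqP z3] /andP[/eqP z4 /eqP z5]].
have z0 : z 0 = 0.
  have := E 1; rewrite /error_field/= z1 z3 !mulr0 subr0 sub0r => /eqP.
  rewrite mulf_eq0 invr_eq0 (gt_eqF D0) orbF oppr_eq0 mulf_eq0.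
  by rewrite (gt_eqF (Ki_gt0 p)) => /eqP.
by apply/funext; exact: ord6P.
Qed.

Lemma solution_coords (x : R -> state R) :
  solution (error_system p omega0 xs) x ->
  (forall i, {within `[0, +oo[, continuous (fun t => state_coord (x t) i)}) /\
  (forall i (t : R), 0 < t -> is_derive t 1 (fun s => state_coord (x s) i)
     (error_field p omega0 xs (state_coord (x t)) i)).
Proof.
move=> [cx dx]; split=> [i t|i t t0].
  by have /cvg_state_coordP := cx t; exact.
have [xd /error_systemE <-] := dx t t0.
by move: i; apply/is_derive_state_coordP; exact: derivableP.
Qed.

Lemma solution_of_coords (y : 'I_6 -> R -> R) :
  (forall i, continuous (y i)) ->
  (forall i (t : R), 0 < t ->
     is_derive t 1 (y i) (error_field p omega0 xs (y ^~ t) i)) ->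
  solution (error_system p omega0 xs) (fun t => of_coords (y ^~ t)).
Proof.
move=> cy dy; split=> [|t t0].
  apply: continuous_subspaceT => t; apply/cvg_state_coordP => i.
  by rewrite of_coordsK; under eq_fun do rewrite of_coordsK; exact: cy.
have [xd xE] : is_derive t 1 (fun s => of_coords (y ^~ s))
    (of_coords (error_field p omega0 xs (y ^~ t))).
  apply/is_derive_state_coordP => i; rewrite of_coordsK.
  by under eq_fun do rewrite of_coordsK; exact: dy.
by split=> //; apply/error_systemE; rewrite xE !of_coordsK.
Qed.

Hypothesis omega0_gt0 : 0 < omega0.
Hypothesis damping :
  Cf p ^+ 2 * enorm (vdq_of xs) ^+ 2 / (4 * (Gf p + Gl p))
     + Lf p ^+ 2 * enorm (idq_of xs) ^+ 2 / (4 * Rf p)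
     < (Gdc p + Kp p) / eta p omega0 ^+ 2.

Lemma error_system_complete : forward_complete (error_system p omega0 xs).
Proof.
move=> x0.
have [eps [lo [hi [k [lo0 hi0 k0 Eb rate]]]]] := strict_lyapunov omega0_gt0 damping.
have [||y [cy y0 dy]] := global_solution lo0 k0 _ rate _ (state_coord x0).
- by move=> x; have /andP[] := Eb x.
- by move=> M M0 i; exact: bounded_lipschitz_error_field.
exists (fun t => of_coords (y ^~ t)); first exact: solution_of_coords.
by apply: state_coord_inj; rewrite of_coordsK; apply/funext.
Qed.

Lemma exponential_decay : exists B k : R, [/\ 0 < B, 0 < k &
  forall x, solution (error_system p omega0 xs) x -> forall t : R, 0 <= t ->
    normsq (state_coord (x t)) <= B * normsq (state_coord (x 0)) * expR (- k * t)].
Proof.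
have [eps [lo [hi [k [lo0 hi0 k0 Eb rate]]]]] := strict_lyapunov omega0_gt0 damping.
exists (hi / lo), k; split=> //; first exact: divr_gt0.
move=> x /solution_coords[cx dx] t t0.
have cxt i : {within `[0, t], continuous (fun s => state_coord (x s) i)}.
  apply: continuous_subspaceW (cx i) => s /=; rewrite !in_itv/= andbT.
  by case/andP.
have := @energy_decay _ _ _ _ _ _ _ _ rate (fun i s => state_coord (x s) i) t t0 cxt
  (fun i s s0 _ => dx i s s0).
have /andP[h1 _] := Eb (state_coord (x t)); have /andP[_ h2] := Eb (state_coord (x 0)).
move=> h3; rewrite -(ler_pM2l lo0); apply: (le_trans h1); apply: (le_trans h3).
rewrite (_ : lo * _ = expR (- k * t) * (hi * normsq (state_coord (x 0)))).
  by rewrite ler_pM2l// expR_gt0.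
by field; rewrite gt_eqF.
Qed.

(** Exponential decay of the squared norm gives both halves.  The factor 6
    compares the squared Euclidean norm of the six coordinates to the square of
    the maximum norm of the state space. *)
Lemma error_system_globally_asymptotically_stable :
  globally_asymptotically_stable (error_system p omega0 xs) 0.
Proof.
have [B [k [B0 k0 decay]]] := exponential_decay.
split; [exact/steady_stateP|exact: error_system_complete| |].
- (* With delta = (eps / 2) / (6 B + 1), 6 B delta ^+ 2 <= (eps / 2) ^+ 2. *)
  move=> eps eps0; pose delta := eps / 2 / (6 * B + 1).
  have B1 : 0 < 6 * B + 1 by rewrite addr_gt0// mulr_gt0.
  have delta0 : 0 < delta by rewrite !divr_gt0.
  exists delta => // x xsol; rewrite subr0 => /ltW.
  move/norm_state_le => /(_ (ltW delta0)) x0 t t0; rewrite subr0.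
  apply: (@le_lt_trans _ _ (eps / 2)); last by rewrite ltr_pdivrMr// ltr_pMr// ltr1n.
  apply/norm_state_le => [|i]; first by rewrite divr_ge0// ltW.
  have e20 : 0 <= eps / 2 by rewrite divr_ge0// ltW.
  rewrite -(@ler_pXn2r _ 2)// ?nnegrE// real_normK ?num_real//.
  apply: (le_trans (sqr_coord_le_normsq _ _)).
  apply: (le_trans (decay _ xsol _ t0)).
  have N6 : normsq (state_coord (x 0)) <= 6 * delta ^+ 2.
    have sq j : state_coord (x 0) j ^+ 2 <= delta ^+ 2.
      rewrite -[leLHS]real_normK ?num_real// ler_pXn2r ?nnegrE//.
      exact: ltW.
    have := (sq 0, sq 1, sq 2, sq 3, sq 4, sq 5).
    by rewrite /normsq => -[[[[[? ?] ?] ?] ?] ?]; lra.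
  have e1 : expR (- k * t) <= 1.
    by rewrite -expR0 ler_expR mulNr oppr_le0 mulr_ge0// ltW.
  apply: (@le_trans _ _ (B * (6 * delta ^+ 2))).
    rewrite -[leRHS]mulr1; apply: ler_pM => //.
    + by rewrite mulr_ge0 ?normsq_ge0// ltW.
    + by rewrite ler_pM2l.
  rewrite (_ : eps / 2 = (6 * B + 1) * delta); last first.
    by rewrite /delta [RHS]mulrC divfK ?gt_eqF.
  have quad (u : R) : B * (6 * u ^+ 2) <= ((6 * B + 1) * u) ^+ 2.
    rewrite exprMn [leLHS]mulrA ler_wpM2r ?sqr_ge0// [B * 6]mulrC.
    have := sqr_ge0 (6 * B); rewrite sqrrD; lra.
  exact: quad.
- move=> x xsol; apply/cvg_state_coordP => i.
  have -> : state_coord (0 : state R) i = 0.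
    by move: i; apply: ord6P; rewrite /state_coord/= ?mxE.
  apply/cvgrPdist_le => e e0.
  pose N := B * normsq (state_coord (x 0)).
  have N0 : 0 <= N by rewrite mulr_ge0 ?normsq_ge0// ltW.
  near=> t.
  have t0 : 0 <= t by near: t; exact: nbhs_pinfty_ge.
  rewrite sub0r normrN -(@ler_pXn2r _ 2)// ?nnegrE ?(ltW e0)//.
  rewrite real_normK ?num_real//.
  apply: (le_trans (sqr_coord_le_normsq _ _)).
  apply: (le_trans (decay _ xsol _ t0)); rewrite -/N mulNr expRN.
  rewrite ler_pdivrMr ?expR_gt0//.
  (* exp (k t) >= k t turns the exponential bound into a linear one. *)
  have ht : N / e ^+ 2 / k <= t by near: t; apply: nbhs_pinfty_ge; exact: num_real.
  rewrite ler_pdivrMr// ler_pdivrMr ?exprn_gt0// in ht.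
  apply: (le_trans ht); rewrite mulrC ler_pM2l ?exprn_gt0//.
  by have := expR_ge1Dx (k * t); rewrite [t * k]mulrC; lra.
Unshelve. all: by end_near. Qed.
End ErrorSystem.

Theorem theorem6 (R : realType) (p : converter R) (omega0 : R)
    (sl : 'cV[R]_2) (xs : state R)
    (omega0_gt0 : 0 < omega0)
    (xs_steady : steady_state (closed_loop p omega0 sl) xs) :
  ((forall x : state R,
      steady_state (error_system p omega0 xs) x <-> x = 0) /\
   eta p omega0 * vdc_of xs = omega0) /\
  (Cf p ^+ 2 * enorm (vdq_of xs) ^+ 2 / (4 * (Gf p + Gl p))
     + Lf p ^+ 2 * enorm (idq_of xs) ^+ 2 / (4 * Rf p)
     < (Gdc p + Kp p) / eta p omega0 ^+ 2 ->
   globally_asymptotically_stable (error_system p omega0 xs) 0).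
Proof.
split; last exact: error_system_globally_asymptotically_stable.
split; first exact: steady_stateP.
case: xs xs_steady => [[[xi v] i] u] [/esym/eqP + _ _ _].
rewrite subr_eq0 /vdc_of/= => /eqP ->.
by rewrite /eta divfK// gt_eqF// vref_gt0.
Qed.
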